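(* For a positive integer $k$, the 1-morphism $W_k$ has the structure of an algebra 1-morphism in $\mathscr{D}$. Moreover, the 1-morphism $S_k$ has the structure of a right $W_k$-module.
   Context: Let $\Bbbk$ be an algebraically closed field of characteristic $0$ and $D=\Bbbk[x]/(x^2)$. Fix a small category $\mathcal{C}$ equivalent to the category $D$-mod of finite dimensional left $D$-modules. The 2-category $\mathscr{D}$ has one object $\mathtt{i}$ (identified with $\mathcal{C}$); its 1-morphisms are all endofunctors of $\mathcal{C}$ isomorphic to tensoring $U\otimes_D-$ with a finite dimensional $D$-$D$-bimodule $U$; its 2-morphisms are all natural transformations (i.e. bimodule homomorphisms). Composition of 1-morphisms is $\otimes_D$, the identity $\mathbbm{1}_{\mathtt{i}}$ corresponds to ${}_DD_D$, and bimodules and the corresponding 1-morphisms are denoted by the same symbols. The $D$-$D$-bimodule $M_k$ has basis $m_1,\dots,m_{2k+3}$ with $m_{2j}x=m_{2j-1}$, $xm_{2j}=m_{2j+1}$ for $1\leq j\leq k+1$, and $x$ annihilates all $m_{i}$ with $i$ odd from both sides; $S_k=M_k/\mathrm{span}\{m_1\}$, $W_k=M_k/\mathrm{span}\{m_1,m_{2k+3}\}$. An algebra structure on a 1-morphism $A\in\mathscr{D}(\mathtt{i},\mathtt{i})$ is a pair of 2-morphisms $\mu:AA\to A$, $\eta:\mathbbm{1}_\mathtt{i}\to A$ with $\mu\circ_v(\mu\circ_h\mathrm{id})=\mu\circ_v(\mathrm{id}\circ_h\mu)$, $\mathrm{id}=\mu\circ_v(\mathrm{id}\circ_h\eta)$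 and $\mathrm{id}=\mu\circ_v(\eta\circ_h\mathrm{id})$, where $\circ_v$ and $\circ_h$ are vertical and horizontal composition. A right $A$-module is a 1-morphism $M$ with a 2-morphism $\rho:MA\to M$ satisfying $\rho\circ_v(\rho\circ_h\mathrm{id})=\rho\circ_v(\mathrm{id}\circ_h\mu)$ and $\mathrm{id}=\rho\circ_v(\mathrm{id}\circ_h\eta)$. *)

(* Defs.v *)
From HB Require Import structures.
From mathcomp Require Import all_boot all_algebra all_field.
From mathcomp Require Import boolp zify.

Set Implicit Arguments.
Unset Strict Implicit.
Unset Printing Implicit Defensive.

Import GRing.Theory passmx.
Local Open Scope ring_scope.
Local Obligation Tactic := idtac.

Record category := Category {
  obj :> Type;
  hom : obj -> obj -> Type;
  idm : forall X, hom X X;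
  cmp : forall X Y Z, hom Y Z -> hom X Y -> hom X Z;
  cmp1m : forall X Y (f : hom X Y), cmp (idm Y) f = f;
  cmpm1 : forall X Y (f : hom X Y), cmp f (idm X) = f;
  cmpA : forall X Y Z T (h : hom Z T) (g : hom Y Z) (f : hom X Y),
    cmp h (cmp g f) = cmp (cmp h g) f }.

Arguments idm {_} X.

Notation "g \oc f" := (cmp g f) (at level 50, left associativity).

Record functor (C E : category) := Functor {
  fobj :> C -> E;
  fmap : forall X Y, hom X Y -> hom (fobj X) (fobj Y);
  fmap1 : forall X, @fmap X X (idm X) = idm (fobj X);
  fmapM : forall X Y Z (g : hom Y Z) (f : hom X Y),
    fmap (g \oc f) = fmap g \oc fmap f }.

Arguments fmap {C E} _ {X Y} f.

Program Definition fid (C : category) : functor C C :=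
  @Functor C C (fun X => X) (fun _ _ f => f) _ _.
Next Obligation. by []. Qed.
Next Obligation. by []. Qed.

Program Definition fcomp (C E G : category) (H : functor E G) (F : functor C E) :
    functor C G :=
  @Functor C G (fun X => H (F X)) (fun _ _ f => fmap H (fmap F f)) _ _.
Next Obligation. by move=> *; rewrite /= !fmap1. Qed.
Next Obligation. by move=> *; rewrite /= !fmapM. Qed.

Record nattrans (C E : category) (F G : functor C E) := NatTrans {
  ntc :> forall X, hom (F X) (G X);
  ntcP : forall X Y (f : hom X Y), ntc Y \oc fmap F f = fmap G f \oc ntc X }.

Program Definition ntid (C E : category) (F : functor C E) : nattrans F F :=
  @NatTrans C E F F (fun X => idm (F X)) _.
Next Obligation. by move=> *; rewrite /= cmp1m cmpm1. Qed.

Program Definition vcomp (C E : category) (F G H : functor C E)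
    (b : nattrans G H) (a : nattrans F G) : nattrans F H :=
  @NatTrans C E F H (fun X => b X \oc a X) _.
Next Obligation. by move=> *; rewrite /= -cmpA ntcP !cmpA ntcP. Qed.

Program Definition hcomp (C E G : category) (H H' : functor E G)
    (F F' : functor C E) (b : nattrans H H') (a : nattrans F F') :
    nattrans (fcomp H F) (fcomp H' F') :=
  @NatTrans C G (fcomp H F) (fcomp H' F') (fun X => b (F' X) \oc fmap H (a X)) _.
Next Obligation.
move=> C E G H H' F F' b a X Y f /=.
by rewrite -cmpA -fmapM (ntcP a) fmapM cmpA (ntcP b) -cmpA.
Qed.

Definition nat_isomorphic (C E : category) (F G : functor C E) : Prop :=
  exists (a : nattrans F G) (b : nattrans G F),
    forall X, b X \oc a X = idm (F X) /\ a X \oc b X = idm (G X).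

Definition equivalence (C E : category) (F : functor C E) : Prop :=
  exists G : functor E C,
    nat_isomorphic (fcomp G F) (fid C) /\ nat_isomorphic (fcomp F G) (fid E).

(* The ambient 2-category is a full sub-2-category of the strict 2-category of
   endofunctors of [C], so its 2-morphisms are all natural transformations.
   Equality of 2-morphisms is stated on components: [(AA)A] and [A(AA)] (and
   [A1], [1A] and [A]) agree on objects and morphisms by conversion, but not
   as [functor] records, because of the proof components. *)
Record algebra (C : category) (A : functor C C) := Algebra {
  alg_mu : nattrans (fcomp A A) A;
  alg_eta : nattrans (fid C) A;
  alg_assoc : forall X,
    vcomp alg_mu (hcomp alg_mu (ntid A)) X
      = vcomp alg_mu (hcomp (ntid A) alg_mu) X;
  alg_unitr : forall X, ntid A X = vcomp alg_mu (hcomp (ntid A) alg_eta) X;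
  alg_unitl : forall X, ntid A X = vcomp alg_mu (hcomp alg_eta (ntid A)) X }.

Record right_module (C : category) (A : functor C C) (sA : algebra A)
    (M : functor C C) := RightModule {
  rmod_rho : nattrans (fcomp M A) M;
  rmod_assoc : forall X,
    vcomp rmod_rho (hcomp rmod_rho (ntid A)) X
      = vcomp rmod_rho (hcomp (ntid M) (alg_mu sA)) X;
  rmod_unit : forall X,
    ntid M X = vcomp rmod_rho (hcomp (ntid M) (alg_eta sA)) X }.

Section Quotient.
Variable K : fieldType.

(* The quotient [V / R] is realised on a complement of [R]. *)
Definition quot (V : vectType K) (R : {vspace V}) : vectType K :=
  subvs_of (R^C)%VS.

Definition quot_pi (V : vectType K) (R : {vspace V}) : 'Hom(V, quot R) :=
  (linfun (vsproj (R^C)%VS) \o daddv_pi (R^C)%VS R)%VF.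

Definition quot_repr (V : vectType K) (R : {vspace V}) : 'Hom(quot R, V) :=
  linfun (vsval : quot R -> V).

Definition quot_map (V V' : vectType K) (R : {vspace V}) (R' : {vspace V'})
    (f : 'Hom(V, V')) : 'Hom(quot R, quot R') :=
  (quot_pi R' \o f \o quot_repr R)%VF.

Lemma quot_reprK (V : vectType K) (R : {vspace V}) :
  cancel (quot_repr R) (quot_pi R).
Proof.
move=> q; rewrite /quot_pi /quot_repr comp_lfunE !lfunE /= daddv_pi_id ?vsvalK //.
  by rewrite capvC capv_compl.
exact: subvsP.
Qed.

Lemma quot_pi_eq0 (V : vectType K) (R : {vspace V}) v :
  (quot_pi R v == 0) = (v \in R).
Proof.
have cap : (R^C :&: R = 0)%VS by rewrite capvC capv_compl.
have full : (v \in R^C + R)%VS by rewrite addvC addv_complf memvf.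
have dec := daddv_pi_add cap full.
rewrite /quot_pi comp_lfunE lfunE /=.
apply/eqP/idP => [e|vR].
  rewrite -dec (_ : daddv_pi _ _ v = 0) ?add0r ?memv_pi //.
  by rewrite -(vsprojK (memv_pi (R^C)%VS R v)) e.
suff -> : daddv_pi (R^C)%VS R v = 0 by rewrite linear0.
apply: (addIr (daddv_pi R (R^C)%VS v)); rewrite dec add0r.
by rewrite daddv_pi_id // capv_compl.
Qed.

Lemma quot_mapE (V V' : vectType K) (R : {vspace V}) (R' : {vspace V'})
    (f : 'Hom(V, V')) v :
  (f @: R <= R')%VS -> quot_map R R' f (quot_pi R v) = quot_pi R' (f v).
Proof.
move=> fR; rewrite /quot_map 2!comp_lfunE; apply/eqP.
rewrite -subr_eq0 -linearB /= quot_pi_eq0 -linearB /=.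
apply: (subvP fR); rewrite memv_img //.
by rewrite -quot_pi_eq0 linearB /= quot_reprK subrr.
Qed.

Lemma quot_map_ext (V W : vectType K) (R : {vspace V}) (f g : 'Hom(quot R, W)) :
  (forall v, f (quot_pi R v) = g (quot_pi R v)) -> f = g.
Proof. by move=> e; apply/lfunP => q; rewrite -(quot_reprK q). Qed.

End Quotient.

Section TensorK.
Variable K : fieldType.
Implicit Types U V : vectType K.

Local Notation bas V := (vbasis {:V}).

(* [U (x)_K V], in coordinates with respect to [bas U] and [bas V]. *)
Definition tensK U V : vectType K := 'M[K]_(\dim {:U}, \dim {:V}).

Definition pureK U V (u : U) (v : V) : tensK U V :=
  (rVof (bas U) u)^T *m rVof (bas V) v.

Definition tmapK U U' V V' (f : 'Hom(U, U')) (g : 'Hom(V, V')) :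
    'Hom(tensK U V, tensK U' V') :=
  linfun (mulmx (mxof (bas U) (bas U') f)^T \o mulmxr (mxof (bas V) (bas V') g)).

Lemma pureK_linl U V (v : V) : linear ((@pureK U V)^~ v).
Proof. by move=> a x y; rewrite /pureK !linearP /= mulmxDl -scalemxAl. Qed.

Lemma pureK_linr U V (u : U) : linear (@pureK U V u).
Proof. by move=> a x y; rewrite /pureK !linearP. Qed.

Lemma tmapK_pure U U' V V' (f : 'Hom(U, U')) (g : 'Hom(V, V')) u v :
  tmapK f g (pureK u v) = pureK (f u) (g v).
Proof.
rewrite lfunE /= /pureK.
have e (A B : vectType K) (h : 'Hom(A, B)) x :
  rVof (bas A) x *m mxof (bas A) (bas B) h = rVof (bas B) (h x).
  by rewrite mul_rV_lin1 /= rVofK // vbasisP.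
by rewrite -!mulmxA e mulmxA -trmx_mul e.
Qed.

Lemma tensK_ext U V (W : vectType K) (f g : 'Hom(tensK U V, W)) :
  (forall u v, f (pureK u v) = g (pureK u v)) -> f = g.
Proof.
move=> e; apply/lfunP => M; rewrite (matrix_sum_delta M) !linear_sum.
apply: eq_bigr => i _; rewrite !linear_sum; apply: eq_bigr => j _.
rewrite !linearZ /=; congr (_ *: _).
have -> : delta_mx i j = pureK (bas U)`_i (bas V)`_j.
  by rewrite /pureK !rVofE ?vbasisP // trmx_delta mul_delta_mx.
exact: e.
Qed.

Lemma tensK_univ U V (W : vectType K) (b : U -> V -> W) :
    (forall v, linear (b^~ v)) -> (forall u, linear (b u)) ->
  exists f : 'Hom(tensK U V, W), forall u v, f (pureK u v) = b u v.
Proof.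
move=> bl br.
pose f (M : tensK U V) := \sum_i \sum_j M i j *: b (bas U)`_i (bas V)`_j.
have fl : linear f.
  move=> c M N; rewrite /f scaler_sumr -big_split; apply: eq_bigr => i _ /=.
  rewrite scaler_sumr -big_split; apply: eq_bigr => j _ /=.
  by rewrite !mxE scalerDl scalerA.
pose L : {linear tensK U V -> W} := HB.pack f (GRing.isLinear.Build _ _ _ _ _ fl).
exists (linfun L) => u v; rewrite lfunE /= /f.
have dec (A : vectType K) (x : A) :
    x = \sum_i rVof (bas A) x 0 i *: (bas A)`_i.
  by rewrite {1}(coord_vbasis (memvf x)); apply: eq_bigr => i _; rewrite mxE.
pose Lr w : {linear V -> W} := HB.pack (b w) (GRing.isLinear.Build _ _ _ _ _ (br w)).
pose Ll w : {linear U -> W} :=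
  HB.pack (b^~ w) (GRing.isLinear.Build _ _ _ _ _ (bl w)).
rewrite [in RHS](dec _ u) -[RHS]/(Ll v _) linear_sum; apply: eq_bigr => i _.
rewrite linearZ /= [in RHS](dec _ v) -[b _ _]/(Lr (bas U)`_i _) linear_sum scaler_sumr.
apply: eq_bigr => j _; rewrite linearZ /= scalerA; congr (_ *: _).
by rewrite mxE big_ord1 mxE.
Qed.

End TensorK.

Section Modules.
Variables (K : fieldType) (D : falgType K).

Record lmodule := LModule {
  lcar :> vectType K;
  lact : D -> 'End(lcar);
  lact_lin : linear lact;
  lact1 : lact 1 = \1%VF;
  lactM : forall a b, lact (a * b) = (lact a \o lact b)%VF }.

(* [K] acts centrally; [ract B a v] is the product [v a]. *)
Record bimodule := Bimodule {
  blmod :> lmodule;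
  ract : D -> 'End(blmod);
  ract_lin : linear ract;
  ract1 : ract 1 = \1%VF;
  ractM : forall a b, ract (a * b) = (ract b \o ract a)%VF;
  lractC : forall a b, (lact blmod a \o ract b)%VF = (ract b \o lact blmod a)%VF }.

Record lmodhom (U V : lmodule) := LModHom {
  lmfun :> 'Hom(U, V);
  lmfunP : forall a, (lmfun \o lact U a)%VF = (lact V a \o lmfun)%VF }.

Lemma lmodhom_eq (U V : lmodule) (f g : lmodhom U V) : lmfun f = lmfun g -> f = g.
Proof.
case: f g => [f fP] [g gP] /= e; case: _ / e gP => gP.
by congr LModHom; apply: Prop_irrelevance.
Qed.

Program Definition lmodhom_id (U : lmodule) : lmodhom U U := @LModHom U U \1%VF _.
Next Obligation. by move=> U a; rewrite comp_lfun1l comp_lfun1r. Qed.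

Program Definition lmodhom_comp (U V W : lmodule) (g : lmodhom V W)
  (f : lmodhom U V) : lmodhom U W := @LModHom U W (g \o f)%VF _.
Next Obligation.
by move=> U V W g f a; rewrite -comp_lfunA lmfunP !comp_lfunA lmfunP.
Qed.

Program Definition modcat : category :=
  @Category lmodule lmodhom lmodhom_id lmodhom_comp _ _ _.
Next Obligation. by move=> *; apply: lmodhom_eq; apply: comp_lfun1l. Qed.
Next Obligation. by move=> *; apply: lmodhom_eq; apply: comp_lfun1r. Qed.
Next Obligation. by move=> *; apply: lmodhom_eq; apply: comp_lfunA. Qed.

Section QuotBimodule.
Variables (B : bimodule) (R : {vspace B}).
Hypothesis stabl : forall a, (lact B a @: R <= R)%VS.
Hypothesis stabr : forall a, (ract B a @: R <= R)%VS.

Program Definition quot_lmodule : lmodule :=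
  @LModule (quot R) (fun a => quot_map R R (lact B a)) _ _ _.
Next Obligation.
move=> c a b; apply: quot_map_ext => v.
by rewrite add_lfunE scale_lfunE !quot_mapE // lact_lin add_lfunE scale_lfunE linearP.
Qed.
Next Obligation. by apply: quot_map_ext => v; rewrite quot_mapE // lact1 !id_lfunE. Qed.
Next Obligation.
move=> a b; apply: quot_map_ext => v.
by rewrite [RHS]comp_lfunE !quot_mapE // lactM comp_lfunE.
Qed.

Program Definition quot_bimodule : bimodule :=
  @Bimodule quot_lmodule (fun a => quot_map R R (ract B a)) _ _ _ _.
Next Obligation.
move=> c a b; apply: quot_map_ext => v.
by rewrite add_lfunE scale_lfunE !quot_mapE // ract_lin add_lfunE scale_lfunE linearP.
Qed.
Next Obligation. by apply: quot_map_ext => v; rewrite quot_mapE // ract1 !id_lfunE. Qed.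
Next Obligation.
move=> a b; apply: quot_map_ext => v.
by rewrite [RHS]comp_lfunE !quot_mapE // ractM comp_lfunE.
Qed.
Next Obligation.
move=> a b; apply: quot_map_ext => v; rewrite [LHS]comp_lfunE [RHS]comp_lfunE !quot_mapE //.
by congr (quot_pi _ _); rewrite -[LHS]comp_lfunE -[RHS]comp_lfunE lractC.
Qed.

End QuotBimodule.

Section Tensor.
Variable U : bimodule.

Definition balance (V : lmodule) (a : D) : 'End(tensK U V) :=
  tmapK (ract U a) \1%VF - tmapK \1%VF (lact V a).

(* The span of all [u a (x) v - u (x) a v]; by linearity it is enough to let
   [a] range over a basis of [D]. *)
Definition tens_rel (V : lmodule) : {vspace tensK U V} :=
  (\sum_(a <- vbasis {:D}) limg (balance V a))%VS.

Definition tens (V : lmodule) : vectType K := quot (tens_rel V).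

Definition pure (V : lmodule) (u : U) (v : V) : tens V :=
  quot_pi (tens_rel V) (pureK u v).

Lemma balanceE V a u v :
  balance V a (pureK u v) = pureK (ract U a u) v - pureK u (lact V a v).
Proof. by rewrite add_lfunE opp_lfunE !tmapK_pure !id_lfunE. Qed.

Lemma pure_linl V v : linear ((@pure V)^~ v).
Proof. by move=> c x y; rewrite /pure pureK_linl linearP. Qed.

Lemma pure_linr V u : linear (@pure V u).
Proof. by move=> c x y; rewrite /pure pureK_linr linearP. Qed.

Lemma balance_rel V a : (limg (balance V a) <= tens_rel V)%VS.
Proof.
have bl : linear (balance V).
  move=> c x y; apply: tensK_ext => u v.
  rewrite [RHS]add_lfunE scale_lfunE !balanceE ract_lin lact_lin !(add_lfunE, scale_lfunE).
  by rewrite pureK_linl pureK_linr scalerBr addrACA opprD.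
apply/subvP => _ /memv_imgP[t _ ->].
have sub (b : D) : b \in vbasis {:D} -> balance V b t \in tens_rel V.
  move=> bD; rewrite /tens_rel (big_rem b) //=.
  by rewrite (subvP (addvSl _ _)) // memv_img // memvf.
have ev : linear (fun b => balance V b t).
  by move=> c x y; rewrite bl add_lfunE scale_lfunE.
rewrite (coord_vbasis (memvf a)).
pose L : {linear D -> tensK U V} := HB.pack (fun b => balance V b t)
  (GRing.isLinear.Build _ _ _ _ _ ev).
rewrite -[balance _ _ _]/(L _) linear_sum rpred_sum // => i _.
by rewrite linearZ rpredZ //= sub // mem_nth // size_tuple.
Qed.

Lemma pure_balanced V a u v : pure (ract U a u) v = pure u (lact V a v).
Proof.
apply/eqP; rewrite -subr_eq0 -linearB /= quot_pi_eq0 -balanceE.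
by rewrite (subvP (balance_rel V a)) // memv_img // memvf.
Qed.

Lemma tens_ext V (W : vectType K) (f g : 'Hom(tens V, W)) :
  (forall u v, f (pure u v) = g (pure u v)) -> f = g.
Proof.
move=> e; apply: quot_map_ext => t.
suff ee : (f \o quot_pi (tens_rel V) = g \o quot_pi (tens_rel V))%VF.
  by rewrite -[LHS]comp_lfunE ee comp_lfunE.
by apply: tensK_ext => u v; rewrite [LHS]comp_lfunE [RHS]comp_lfunE; apply: e.
Qed.

(* Every balanced bilinear map factors through [tens]. *)
Lemma tens_univ (V : lmodule) (W : vectType K) (b : U -> V -> W) :
    (forall v, linear (b^~ v)) -> (forall u, linear (b u)) ->
    (forall a u v, b (ract U a u) v = b u (lact V a v)) ->
  exists f : 'Hom(tens V, W), forall u v, f (pure u v) = b u v.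
Proof.
move=> bl br bb; have [f0 f0P] := tensK_univ bl br.
exists (f0 \o quot_repr (tens_rel V))%VF => u v.
rewrite comp_lfunE -f0P; apply/eqP; rewrite -subr_eq0 -linearB /= -memv_ker.
apply: (@subvP _ _ (tens_rel V)); last first.
  by rewrite -quot_pi_eq0 linearB /= quot_reprK subrr.
apply: (big_ind (fun X => X <= lker f0)%VS) => [|X Y hX hY|a _].
- exact: sub0v.
- by rewrite subv_add hX.
apply/subvP => _ /memv_imgP[t _ ->]; rewrite memv_ker -comp_lfunE.
rewrite (_ : (f0 \o balance V a)%VF = 0) ?zero_lfunE //.
apply: tensK_ext => x y.
by rewrite [LHS]comp_lfunE balanceE linearB /= !f0P bb subrr zero_lfunE.
Qed.

Lemma tmap_rel (V V' : lmodule) (f : 'End(U)) (g : 'Hom(V, V')) :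
    (forall a, (f \o ract U a)%VF = (ract U a \o f)%VF) ->
    (forall a, (g \o lact V a)%VF = (lact V' a \o g)%VF) ->
  (tmapK f g @: tens_rel V <= tens_rel V')%VS.
Proof.
move=> fP gP; rewrite {1}/tens_rel.
apply: (big_ind (fun X => tmapK f g @: X <= tens_rel V')%VS) => [|X Y hX hY|a _].
- by rewrite limg0 sub0v.
- by rewrite limgD subv_add hX.
apply: subv_trans (balance_rel V' a).
suff e : (tmapK f g \o balance V a = balance V' a \o tmapK f g)%VF.
  by rewrite -limg_comp e limg_comp limgS ?subvf.
apply: tensK_ext => u v; rewrite [LHS]comp_lfunE [RHS]comp_lfunE.
rewrite balanceE linearB /= !tmapK_pure balanceE.
by rewrite -(comp_lfunE f) fP comp_lfunE -(comp_lfunE g) gP comp_lfunE.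
Qed.

Definition tmap (V V' : lmodule) (f : 'End(U)) (g : 'Hom(V, V')) :
    'Hom(tens V, tens V') :=
  quot_map (tens_rel V) (tens_rel V') (tmapK f g).

Lemma tmap_pure (V V' : lmodule) (f : 'End(U)) (g : 'Hom(V, V')) u v :
    (forall a, (f \o ract U a)%VF = (ract U a \o f)%VF) ->
    (forall a, (g \o lact V a)%VF = (lact V' a \o g)%VF) ->
  tmap f g (pure u v) = pure (f u) (g v).
Proof. by move=> fP gP; rewrite /tmap quot_mapE ?tmapK_pure //; apply: tmap_rel. Qed.

Lemma lact_tens_comm a b : (lact U a \o ract U b)%VF = (ract U b \o lact U a)%VF.
Proof. exact: lractC. Qed.

Lemma id_comm (V : lmodule) a : (\1 \o lact V a)%VF = (lact V a \o \1)%VF.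
Proof. by rewrite comp_lfun1l comp_lfun1r. Qed.

(* [U (x)_D V], with [a (u (x) v) = (a u) (x) v]. *)
Program Definition tens_lmodule (V : lmodule) : lmodule :=
  @LModule (tens V) (fun a => tmap (lact U a) (\1%VF : 'Hom(V, V))) _ _ _.
Next Obligation.
move=> V c a b; apply: tens_ext => u v.
rewrite [RHS]add_lfunE scale_lfunE.
rewrite !(tmap_pure _ _ (lact_tens_comm _) (@id_comm V)).
by rewrite lact_lin add_lfunE scale_lfunE pure_linl.
Qed.
Next Obligation.
move=> V; apply: tens_ext => u v.
by rewrite (tmap_pure _ _ (lact_tens_comm _) (@id_comm V)) lact1 !id_lfunE.
Qed.
Next Obligation.
move=> V a b; apply: tens_ext => u v; rewrite [RHS]comp_lfunE.
by rewrite !(tmap_pure _ _ (lact_tens_comm _) (@id_comm V)) lactM comp_lfunE !id_lfunE.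
Qed.

Lemma lact_pure V a u v : lact (tens_lmodule V) a (pure u v) = pure (lact U a u) v.
Proof. by rewrite (tmap_pure _ _ (lact_tens_comm _) (@id_comm V)) id_lfunE. Qed.

Lemma id_comm_r a : (\1 \o ract U a)%VF = (ract U a \o \1)%VF.
Proof. by rewrite comp_lfun1l comp_lfun1r. Qed.

Program Definition tens_hom (V V' : lmodule) (g : lmodhom V V') :
    lmodhom (tens_lmodule V) (tens_lmodule V') :=
  @LModHom (tens_lmodule V) (tens_lmodule V') (tmap (\1%VF : 'End(U)) g) _.
Next Obligation.
move=> V V' g a; apply: tens_ext => u v; rewrite [LHS]comp_lfunE [RHS]comp_lfunE.
by rewrite lact_pure !(tmap_pure _ _ id_comm_r (lmfunP g)) lact_pure !id_lfunE.
Qed.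

Lemma tens_hom_pure (V V' : lmodule) (g : lmodhom V V') u v :
  tens_hom g (pure u v) = pure u (g v).
Proof. by rewrite (tmap_pure _ _ id_comm_r (lmfunP g)) id_lfunE. Qed.

Program Definition tens_functor : functor modcat modcat :=
  @Functor modcat modcat tens_lmodule tens_hom _ _.
Next Obligation.
move=> V; apply: lmodhom_eq; apply: tens_ext => u v.
by rewrite tens_hom_pure !id_lfunE.
Qed.
Next Obligation.
move=> V V' V'' g f; apply: lmodhom_eq; apply: tens_ext => u v.
by rewrite [RHS]comp_lfunE !tens_hom_pure comp_lfunE.
Qed.

End Tensor.

(* [F] is the 1-morphism given by [U], where the object [C] of the 2-category
   is identified with [D]-mod along [E]. *)
Definition represents (C : category) (E : functor C modcat) (U : bimodule)
    (F : functor C C) : Prop :=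
  nat_isomorphic (fcomp E F) (fcomp (tens_functor U) E).

Lemma represented (C : category) (E : functor C modcat) (U : bimodule) :
  equivalence E -> exists F : functor C C, represents E U F.
Proof.
case=> G [_ [a [b ab]]]; exists (fcomp G (fcomp (tens_functor U) E)).
pose T := fcomp (tens_functor U) E.
exists (@NatTrans C modcat (fcomp E (fcomp G T)) T (fun X => a (T X))
         (fun X Y f => ntcP a (fmap T f))).
exists (@NatTrans C modcat T (fcomp E (fcomp G T)) (fun X => b (T X))
         (fun X Y f => ntcP b (fmap T f))).
by move=> X; apply: ab.
Qed.

End Modules.

Notation dual_numbers K := {poly %/ ('X^2 : {poly K})}.

HB.instance Definition _ (K : fieldType) (h : {poly K}) := Vector.on {poly %/ h}.

Section DualNumbers.
Variable K : fieldType.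
Local Notation D := (dual_numbers K).

Lemma mk_monic_X2 : mk_monic ('X^2 : {poly K}) = 'X^2.
Proof. by rewrite /mk_monic size_polyXn monicXn. Qed.

Lemma dual_coefM (a b : D) i : (i < 2)%N -> (a * b : D)`_i = ((a : {poly K}) * b)`_i.
Proof.
move=> i2; have -> : (a * b : D) = Pdiv.CommonRing.rmodp ((a : {poly K}) * b) 'X^2 :> {poly K}.
  by rewrite -[X in Pdiv.CommonRing.rmodp _ X]mk_monic_X2.
rewrite [in RHS](Pdiv.RingMonic.rdivp_eq (monicXn K 2) ((a : {poly K}) * b)).
by rewrite coefD coefMXn i2 add0r.
Qed.

Lemma dual_coefM0 (a b : D) : (a * b : D)`_0 = a`_0 * b`_0.
Proof. by rewrite dual_coefM // coef0M. Qed.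

Lemma dual_coefM1 (a b : D) : (a * b : D)`_1 = a`_0 * b`_1 + a`_1 * b`_0.
Proof. by rewrite dual_coefM // coefM !big_ord_recl big_ord0 addr0. Qed.

(* The action of [D] in which [x] acts by [X]. *)
Definition dual_act (V : vectType K) (X : 'End(V)) (a : D) : 'End(V) :=
  a`_0 *: \1%VF + a`_1 *: X.

Lemma dual_act_lin V X : linear (@dual_act V X).
Proof.
move=> c a b; rewrite /dual_act /= !coefD !coefZ !scalerDl scalerDr !scalerA.
by rewrite addrACA.
Qed.

Lemma dual_act1 V X : @dual_act V X 1 = \1%VF.
Proof. by rewrite /dual_act /= !coefC /= scale1r scale0r addr0. Qed.

Lemma dual_actX V X : @dual_act V X 'qX = X.
Proof.
rewrite /dual_act qpolyXE ?size_polyXn ?monicXn // !coefX /=.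
by rewrite scale1r scale0r add0r.
Qed.

Lemma dual_actM V X a b : (X \o X = 0)%VF ->
  @dual_act V X (a * b) = (dual_act X a \o dual_act X b)%VF.
Proof.
move=> X2; apply/lfunP => v; move/lfunP/(_ v): X2; rewrite comp_lfunE zero_lfunE => X2.
rewrite comp_lfunE /dual_act dual_coefM0 dual_coefM1.
rewrite !(add_lfunE, scale_lfunE, id_lfunE) !linearD !linearZ /= X2 !scaler0 addr0.
by rewrite !scalerA scalerDl addrA ![b`_ _ * _]mulrC.
Qed.

Lemma dual_actC V X Y a b : (X \o Y = Y \o X)%VF ->
  (@dual_act V X a \o dual_act Y b)%VF = (dual_act Y b \o dual_act X a)%VF.
Proof.
move=> XY; rewrite /dual_act !(comp_lfunDl, comp_lfunDr).
rewrite -!(comp_lfunZl, comp_lfunZr) !(comp_lfun1l, comp_lfun1r) XY.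
by rewrite !scalerA ![b`_ _ * _]mulrC addrACA.
Qed.

(* A [D]-[D]-bimodule is a space with commuting square-zero operators [X] and
   [Y], the left and right multiplications by [x]. *)
Section DualBimodule.
Variables (V : vectType K) (X Y : 'End(V)).
Hypotheses (X2 : (X \o X = 0)%VF) (Y2 : (Y \o Y = 0)%VF).
Hypothesis XY : (X \o Y = Y \o X)%VF.

Definition dual_lmodule : lmodule D :=
  LModule (@dual_act_lin V X) (dual_act1 X) (fun a b => dual_actM a b X2).

Lemma dual_ractM (a b : D) :
  dual_act Y (a * b) = (dual_act Y b \o dual_act Y a)%VF.
Proof. by rewrite mulrC dual_actM. Qed.

Definition dual_bimodule : bimodule D :=
  @Bimodule K D dual_lmodule (dual_act Y) (@dual_act_lin V Y) (dual_act1 Y)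
    dual_ractM (fun a b => dual_actC a b XY).

End DualBimodule.

Variable k : nat.

(* [mvec i] is [m_i] for [1 <= i <= 2k + 3], and [0] otherwise. *)
Definition mvec (i : nat) : 'rV[K]_(2 * k + 3) := \row_j (j.+1 == i)%:R.

(* The linear map sending [m_(2j)] to [m_(f j)] for [1 <= j <= k + 1], and
   [m_i] to [0] for [i] odd; row and column numbers start from 0. *)
Definition mshift (f : nat -> nat) : 'End('rV[K]_(2 * k + 3)) :=
  linfun (mulmxr (\matrix_(i, l) (odd i && (l.+1 == f i.+1./2))%:R)).

Definition xl := mshift (fun j => 2 * j + 1)%N.
Definition xr := mshift (fun j => 2 * j - 1)%N.

Lemma mvec_delta (i : 'I_(2 * k + 3)) : mvec i.+1 = delta_mx 0 i.
Proof. by apply/rowP => j; rewrite !mxE eqxx eqSS. Qed.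

Lemma mshiftE f (i : 'I_(2 * k + 3)) :
  mshift f (mvec i.+1) = if odd i then mvec (f i.+1./2) else 0.
Proof.
rewrite mvec_delta lfunE /= -rowE; apply/rowP => l; rewrite !mxE.
by case: odd; rewrite mxE.
Qed.

Lemma mshift_even f j : (1 <= j <= k.+1)%N -> mshift f (mvec (2 * j)) = mvec (f j).
Proof.
case: j => // j /= jk; have lt : (2 * j + 1 < 2 * k + 3)%N by lia.
have -> : (2 * j.+1 = (Ordinal lt).+1)%N by rewrite /=; lia.
rewrite mshiftE /= oddD oddM /=; congr (mvec (f _)); lia.
Qed.

Lemma mshift_odd f j : mshift f (mvec (2 * j + 1)) = 0.
Proof.
case: (ltnP (2 * j) (2 * k + 3)) => [lt|ge].
  by rewrite addn1 (mshiftE f (Ordinal lt)) /= oddM.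
suff -> : mvec (2 * j + 1) = 0 by rewrite linear0.
by apply/rowP => l; rewrite !mxE; case: eqP => // e; have := ltn_ord l; lia.
Qed.

Lemma xlE j : (1 <= j <= k.+1)%N -> xl (mvec (2 * j)) = mvec (2 * j + 1).
Proof. exact: mshift_even. Qed.

Lemma xrE j : (1 <= j <= k.+1)%N -> xr (mvec (2 * j)) = mvec (2 * j - 1).
Proof. exact: mshift_even. Qed.

Lemma mvec_ext (V : vectType K) (f g : 'Hom('rV[K]_(2 * k + 3), V)) :
  (forall i : 'I_(2 * k + 3), f (mvec i.+1) = g (mvec i.+1)) -> f = g.
Proof.
move=> e; apply/lfunP => v; rewrite (row_sum_delta v) !linear_sum.
by apply: eq_bigr => i _; rewrite !linearZ /= -mvec_delta e.
Qed.

Lemma mshift_comp f g : (forall j, (0 < j)%N -> odd (f j)) ->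
  (mshift g \o mshift f = 0)%VF.
Proof.
move=> fo; apply: mvec_ext => i; rewrite [LHS]comp_lfunE zero_lfunE mshiftE.
case: ifP => oi; last by rewrite linear0.
have o : odd (f i.+1./2) by apply: fo; lia.
have -> : f i.+1./2 = (2 * (f i.+1./2)./2 + 1)%N by lia.
exact: mshift_odd.
Qed.

Lemma odd_l j : (0 < j)%N -> odd (2 * j + 1). Proof. by lia. Qed.
Lemma odd_r j : (0 < j)%N -> odd (2 * j - 1). Proof. by lia. Qed.

Lemma xlr : (xl \o xr = xr \o xl)%VF.
Proof. by rewrite /xl /xr (mshift_comp _ odd_l) (mshift_comp _ odd_r). Qed.

Definition M_bimod : bimodule D :=
  dual_bimodule (mshift_comp _ odd_l) (mshift_comp _ odd_r) xlr.

Lemma lact_M : lact M_bimod 'qX = xl.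
Proof. exact: dual_actX. Qed.

Lemma ract_M : ract M_bimod 'qX = xr.
Proof. exact: dual_actX. Qed.

Definition S_rel : {vspace M_bimod} := <<[:: mvec 1]>>%VS.
Definition W_rel : {vspace M_bimod} := <<[:: mvec 1; mvec (2 * k + 3)]>>%VS.

Lemma span_stable (s : seq 'rV[K]_(2 * k + 3)) f (a : D) :
    (forall v, v \in s -> mshift f v = 0) ->
  (dual_act (mshift f) a @: <<s>> <= <<s>>)%VS.
Proof.
move=> fs; rewrite limg_span; apply/span_subvP => _ /mapP[v vs ->].
rewrite add_lfunE !scale_lfunE id_lfunE fs // scaler0 addr0.
by rewrite memvZ // memv_span.
Qed.

Lemma S_rel_shift f v : v \in [:: mvec 1] -> mshift f v = 0.
Proof. by rewrite inE => /eqP ->; apply: (mshift_odd f 0). Qed.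

Lemma W_rel_shift f v : v \in [:: mvec 1; mvec (2 * k + 3)] -> mshift f v = 0.
Proof.
rewrite !inE => /orP[]/eqP ->; first exact: (mshift_odd f 0).
by rewrite -(mshift_odd f k.+1); congr (mshift f (mvec _)); lia.
Qed.

Definition S_bimod : bimodule D :=
  @quot_bimodule K D M_bimod S_rel
    (fun a => span_stable a (@S_rel_shift _)) (fun a => span_stable a (@S_rel_shift _)).

Definition W_bimod : bimodule D :=
  @quot_bimodule K D M_bimod W_rel
    (fun a => span_stable a (@W_rel_shift _)) (fun a => span_stable a (@W_rel_shift _)).

End DualNumbers.

(* Main.v *)
Require Import Defs.
From HB Require Import structures.
From mathcomp Require Import all_boot all_algebra all_field.
From mathcomp Require Import boolp ring zify.
(* Imported again so that [hom] is the one of [category], not that of linear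
   maps. *)
Import Defs.

Set Implicit Arguments.
Unset Strict Implicit.
Unset Printing Implicit Defensive.

Import GRing.Theory.
Local Open Scope ring_scope.

(** Write e_j for m_(2j) and a_j for m_(2j+1).  In W_k, which has basis
    e_1, ..., e_(k+1), a_1, ..., a_k, the bimodule relations read
    x e_j = a_j = e_(j+1) x for 1 <= j <= k, the other products being 0.  Take for the e_j the trivial paths and for the a_j
    the arrows j -> j+1 of the linear quiver with k+1 vertices, products of two
    arrows being zero: the path algebra obtained has the basis of W_k, the sum
    of its arrows squares to zero, and multiplying on either side by this sum is
    the given action of x.  So W_k is this algebra, restricted along the map
    from D that sends x to the sum of the arrows.

    The module S_k has one more basis vector a_(k+1), an arrow leaving the vertex
    k+1; it is stable under right multiplication by the algebra, and the left
    action of x commutes with that multiplication.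

    Both products come from one product on M_k, that of a longer linear quiver in
    which the vertices 0 and k+2 have been deleted but the arrows a_0 and a_(k+1)
    kept.  This product has no unit, but it is associative and D-bilinear
    ([M_pairing]), and it descends to products W_k x W_k -> W_k and
    S_k x W_k -> S_k ([quot_pairing]), for which the class of
    e_1 + ... + e_(k+1) is a unit ([mmul_unitl], [mmul_unitr]).

    It remains to pass from elements to 2-morphisms.  A balanced pairing of
    bimodules U x U' -> U'' is the same thing as a map from U (x) U' to U'', hence
    gives a natural transformation between tensor functors, and identities
    between products of elements become identities between natural
    transformations ([pairing_algebra]).  This gives the structures on the
    tensor functors of D-modules; they are carried to the endofunctors of the
    equivalent category by conjugation, an equivalence being fully faithful
    ([algebra_module_transport]). *)

(** * Transport of algebras and modules along an equivalence *)

(** Naturality of the isomorphism recovers [f] from [fmap G (fmap F f)]. *)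
Lemma left_inverse_faithful (C B : category) (F : functor C B) (G : functor B C) :
    nat_isomorphic (fcomp G F) (fid C) ->
  forall (X Y : C) (f g : hom X Y), fmap F f = fmap F g -> f = g.
Proof.
case=> c [c' cc'] X Y f g efg; rewrite -(cmpm1 f) -(cmpm1 g) -(cc' X).2 !cmpA.
have := congr1 (fun h => c Y \oc fmap G h) efg.
by rewrite /= (ntcP c f) (ntcP c g) /= => ->.
Qed.

(** The preimage of [h] is the conjugate of [fmap G h] by the isomorphism from
    [G F] to the identity.  That it is mapped to [h] can be tested after applying
    [G], which is faithful because [F G] is isomorphic to the identity. *)
Lemma equivalence_fully_faithful (C B : category) (F : functor C B) : equivalence F ->
  exists lift : forall X Y : C, hom (F X) (F Y) -> hom X Y,
    (forall X Y (h : hom (F X) (F Y)), fmap F (lift X Y h) = h) /\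
    (forall (X Y : C) (f g : hom X Y), fmap F f = fmap F g -> f = g).
Proof.
case=> G [isoGF isoFG]; have faithG := left_inverse_faithful isoFG.
case: (isoGF) => c [c' /= cc'].
exists (fun X Y h => c Y \oc fmap G h \oc c' X).
split; last exact: left_inverse_faithful isoGF.
move=> X Y h; apply: faithG; set f := (X in fmap F X).
rewrite -[LHS]cmp1m -(cc' Y).1 -cmpA [c Y \oc _](ntcP c f) /= {}/f.
by rewrite -!cmpA (cc' X).1 cmpm1 cmpA (cc' Y).1 cmp1m.
Qed.

(** In what follows [lift] inverts the action of [E] on morphisms; [p] and [a] are
    to be isomorphisms, so that [P] and [A] correspond to [N] and [T] along [E].
    The construction is made for an action of [T] on any [N], since the
    multiplication of [A] is the case [P = A], [N = T]. *)
Section Transport.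
Variables (C B : category) (E : functor C B).
Variable lift : forall X Y : C, hom (E X) (E Y) -> hom X Y.
Hypothesis liftK : forall X Y (h : hom (E X) (E Y)), fmap E (lift h) = h.
Hypothesis faithful : forall (X Y : C) (f g : hom X Y), fmap E f = fmap E g -> f = g.

Variables (P A : functor C C) (N T : functor B B).
Variables (p : nattrans (fcomp E P) (fcomp N E)) (p' : nattrans (fcomp N E) (fcomp E P)).
Variables (a : nattrans (fcomp E A) (fcomp T E)) (a' : nattrans (fcomp T E) (fcomp E A)).

Definition transport_act_comp (rho : nattrans (fcomp N T) N) X : hom (fcomp P A X) (P X) :=
  lift (p' X \oc (rho (E X) \oc (fmap N (a X) \oc p (A X)))).

Lemma transport_act_natural rho X Y (f : hom X Y) :
  transport_act_comp rho Y \oc fmap (fcomp P A) f = fmap P f \oc transport_act_comp rho X.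
Proof.
apply: faithful; rewrite !fmapM !liftK /=.
rewrite -!cmpA (ntcP p) /= [fmap N _ \oc (_ \oc _)]cmpA -fmapM (ntcP a) fmapM -cmpA /=.
rewrite [rho (E Y) \oc _]cmpA (ntcP rho) -cmpA.
by rewrite cmpA (ntcP p') -cmpA.
Qed.

Definition transport_act rho : nattrans (fcomp P A) P :=
  NatTrans (@transport_act_natural rho).

Definition transport_unit_comp (eta : nattrans (fid B) T) X : hom (fid C X) (A X) :=
  lift (a' X \oc eta (E X)).

Lemma transport_unit_natural eta X Y (f : hom X Y) :
  transport_unit_comp eta Y \oc fmap (fid C) f = fmap A f \oc transport_unit_comp eta X.
Proof.
apply: faithful; rewrite !fmapM !liftK /=.
by rewrite -cmpA (ntcP eta (fmap E f)) [LHS]cmpA (ntcP a' f) -cmpA.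
Qed.

Definition transport_unit eta : nattrans (fid C) A :=
  NatTrans (@transport_unit_natural eta).

End Transport.

Section TransportLaws.
Variables (C B : category) (E : functor C B).
Variable lift : forall X Y : C, hom (E X) (E Y) -> hom X Y.
Hypothesis liftK : forall X Y (h : hom (E X) (E Y)), fmap E (lift h) = h.
Hypothesis faithful : forall (X Y : C) (f g : hom X Y), fmap E f = fmap E g -> f = g.

Variables (A : functor C C) (T : functor B B).
Variables (a : nattrans (fcomp E A) (fcomp T E)) (a' : nattrans (fcomp T E) (fcomp E A)).
Hypothesis aK : forall X, a' X \oc a X = idm (E (A X)).
Hypothesis a'K : forall X, a X \oc a' X = idm (T (E X)).
Variable sT : algebra T.

Let mu := transport_act liftK faithful a a' a (alg_mu sT).
Let eta := transport_unit liftK faithful a' (alg_eta sT).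

Let fmap_mu X : fmap E (mu X) =
  a' X \oc (alg_mu sT (E X) \oc (fmap T (a X) \oc a (A X))).
Proof. exact: liftK. Qed.

Let fmap_eta X : fmap E (eta X) = a' X \oc alg_eta sT (E X).
Proof. exact: liftK. Qed.

Section ModuleLaws.
Variables (P : functor C C) (N : functor B B).
Variables (p : nattrans (fcomp E P) (fcomp N E)) (p' : nattrans (fcomp N E) (fcomp E P)).
Hypothesis pK : forall X, p' X \oc p X = idm (E (P X)).
Hypothesis p'K : forall X, p X \oc p' X = idm (N (E X)).
Variable rho : nattrans (fcomp N T) N.

Let rhoC := transport_act liftK faithful p p' a rho.

Let fmap_rhoC X : fmap E (rhoC X) =
  p' X \oc (rho (E X) \oc (fmap N (a X) \oc p (A X))).
Proof. exact: liftK. Qed.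

(** The inner [p'] cancels against the next [p]; once the [a] and [p] are moved
    to the right by naturality, what is left is associativity of [rho]. *)
Lemma transport_assoc :
    (forall Y, vcomp rho (hcomp rho (ntid T)) Y
               = vcomp rho (hcomp (ntid N) (alg_mu sT)) Y) ->
  forall X, vcomp rhoC (hcomp rhoC (ntid A)) X = vcomp rhoC (hcomp (ntid P) mu) X.
Proof.
(* Hiding the bodies keeps simplification from unfolding them to lifts. *)
move: rhoC fmap_rhoC mu fmap_mu => r rE m mE assoc X.
apply: faithful; move: (assoc (E X)) => /=.
rewrite !fmap1 !cmpm1 !cmp1m => {}assoc.
rewrite !fmapM !rE -!cmpA.
rewrite (ntcP p (m X)) /= (cmpA (fmap N (a X)) (fmap N _)) -fmapM mE.
rewrite [p (A X) \oc _]cmpA p'K cmp1m.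
rewrite [a X \oc _]cmpA a'K cmp1m !fmapM -!cmpA.
congr (_ \oc _); rewrite [RHS]cmpA -assoc -!cmpA; congr (_ \oc _).
by rewrite cmpA -(ntcP rho) -cmpA.
Qed.

Lemma transport_unitr :
    (forall Y, ntid N Y = vcomp rho (hcomp (ntid N) (alg_eta sT)) Y) ->
  forall X, ntid P X = vcomp rhoC (hcomp (ntid P) eta) X.
Proof.
move: rhoC fmap_rhoC eta fmap_eta => r rE e eE unit X.
apply: faithful; move: (unit (E X)) => /=.
rewrite !cmp1m => {}unit.
rewrite fmapM fmap1 rE -!cmpA (ntcP p (e X)) /=.
rewrite (cmpA (fmap N (a X)) (fmap N _)) -fmapM eE.
by rewrite [a X \oc _]cmpA a'K cmp1m [rho _ \oc _]cmpA -unit cmp1m pK.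
Qed.

End ModuleLaws.

Lemma transport_unitl X : ntid A X = vcomp mu (hcomp eta (ntid A)) X.
Proof.
move: mu fmap_mu eta fmap_eta => m mE e eE.
apply: faithful; move: (alg_unitl sT (E X)) => /=.
rewrite !cmpm1 => unit.
rewrite /= ?cmpm1 fmapM fmap1 mE eE -!cmpA.
rewrite [a (A X) \oc _]cmpA a'K cmp1m -(ntcP (alg_eta sT) (a X)) /=.
by rewrite [alg_mu _ _ \oc _]cmpA -unit cmp1m aK.
Qed.

Definition transport_algebra : algebra A :=
  Algebra (transport_assoc a'K (alg_assoc sT)) (transport_unitr aK (alg_unitr sT))
    transport_unitl.

Definition transport_module (P : functor C C) (N : functor B B)
    (p : nattrans (fcomp E P) (fcomp N E)) (p' : nattrans (fcomp N E) (fcomp E P))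
    (pK : forall X, p' X \oc p X = idm (E (P X)))
    (p'K : forall X, p X \oc p' X = idm (N (E X)))
    (sN : right_module sT N) : right_module transport_algebra P :=
  @RightModule _ _ transport_algebra P _ (transport_assoc p'K (rmod_assoc sN))
    (transport_unitr pK (rmod_unit sN)).

End TransportLaws.

(** Conjugation by the isomorphisms gives transformations [E A A -> E A] and
    [E P A -> E P], which lift since [E] is fully faithful. *)
Lemma algebra_module_transport (C B : category) (E : functor C B) (eqE : equivalence E)
    (A P : functor C C) (T N : functor B B) (sT : algebra T) :
    nat_isomorphic (fcomp E A) (fcomp T E) -> nat_isomorphic (fcomp E P) (fcomp N E) ->
    right_module sT N ->
  exists sA : algebra A, inhabited (right_module sA P).
Proof.
case: (equivalence_fully_faithful eqE) => lift [liftK faithful].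
case=> a [a' aP] [p [p' pP]] sN.
exists (transport_algebra liftK faithful (fun X => (aP X).1) (fun X => (aP X).2) sT).
split; exact: (transport_module _ _ _ _ (fun X => (pP X).1) (fun X => (pP X).2) sN).
Qed.

(** * Products of elements and natural transformations of tensor functors *)

Lemma vcompE (C E : category) (F G H : functor C E) (b : nattrans G H)
  (a : nattrans F G) X : vcomp b a X = b X \oc a X.
Proof. by []. Qed.

Lemma hcomp_ntidr (C E G : category) (H H' : functor E G) (F : functor C E)
  (b : nattrans H H') X : hcomp b (ntid F) X = b (F X).
Proof. by rewrite /= fmap1 cmpm1. Qed.

Lemma hcomp_ntidl (C E G : category) (H : functor E G) (F F' : functor C E)
  (a : nattrans F F') X : hcomp (ntid H) a X = fmap H (a X).
Proof. by rewrite /= cmp1m. Qed.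

Section Pairings.
Variables (K : fieldType) (D : falgType K).
Implicit Types U : bimodule D.

Lemma linear_homP (V V' : vectType K) (f : V -> V') : linear f ->
  exists g : 'Hom(V, V'), forall v, g v = f v.
Proof.
move=> lf.
pose L : {linear V -> V'} := HB.pack f (GRing.isLinear.Build _ _ _ _ _ lf).
by exists (linfun L) => v; rewrite lfunE.
Qed.

Lemma tens_lmod_univ U (V : lmodule D) (V' : lmodule D) (b : U -> V -> V') :
    (forall v, linear (b^~ v)) -> (forall u, linear (b u)) ->
    (forall a u v, b (ract U a u) v = b u (lact V a v)) ->
    (forall a u v, b (lact U a u) v = lact V' a (b u v)) ->
  exists f : lmodhom (tens_lmodule U V) V', forall u v, f (pure u v) = b u v.
Proof.
move=> bl br bb bD; have [f fE] := tens_univ bl br bb.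
unshelve refine (ex_intro _ (@LModHom _ _ (tens_lmodule U V) V' f _) fE).
move=> a; apply: tens_ext => u v.
by rewrite [LHS]comp_lfunE [RHS]comp_lfunE lact_pure !fE bD.
Qed.

(** For fixed [u], the tensor [u (x) t] is linear in [t], so that [t] may be taken
    to be pure. *)
Lemma tens_ext2 U U' (V : lmodule D) (V' : vectType K)
    (f g : 'Hom(tens U (tens_lmodule U' V), V')) :
  (forall u u' v, f (pure u (pure u' v : tens_lmodule U' V))
                = g (pure u (pure u' v : tens_lmodule U' V))) -> f = g.
Proof.
move=> e; apply: tens_ext => u t.
have [h hE] := linear_homP (pure_linr (V := tens_lmodule U' V) u).
rewrite -!hE -!comp_lfunE; congr (fun_of_lfun _ t).
by apply: tens_ext => u' v; rewrite !comp_lfunE !hE.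
Qed.

Lemma tens_ext3 U U' U'' (V : lmodule D) (V' : vectType K)
    (f g : 'Hom(tens U (tens_lmodule U' (tens_lmodule U'' V)), V')) :
  (forall u u' u'' v,
    f (pure u (pure u' (pure u'' v : tens_lmodule U'' V) : tens_lmodule U' _))
    = g (pure u (pure u' (pure u'' v : tens_lmodule U'' V) : tens_lmodule U' _))) ->
  f = g.
Proof.
move=> e; apply: tens_ext2 => u u' t.
have [h hE] := linear_homP (pure_linr (V := tens_lmodule U' (tens_lmodule U'' V)) u).
have [h' h'E] := linear_homP (pure_linr (V := tens_lmodule U'' V) u').
rewrite -h'E -hE -!comp_lfunE; congr (fun_of_lfun _ t).
by apply: tens_ext => u'' v; rewrite !comp_lfunE !hE !h'E.
Qed.

(** These are the bimodule homomorphisms from [U (x)_D U'] to [U''], described by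
    their values on pure tensors: this avoids having to put a bimodule structure
    on the tensor product. *)
Record pairing (U U' U'' : bimodule D) := Pairing {
  pmul :> U -> U' -> U'';
  pmul_linl : forall u', linear (pmul^~ u');
  pmul_linr : forall u, linear (pmul u);
  pmul_balanced : forall a u u', pmul (ract U a u) u' = pmul u (lact U' a u');
  pmul_lact : forall a u u', pmul (lact U a u) u' = lact U'' a (pmul u u');
  pmul_ract : forall a u u', pmul u (ract U' a u') = ract U'' a (pmul u u') }.

(** Right linearity of the pairing is what makes [m u u' (x) v] balanced in [u']
    and [v]. *)
Lemma pairing_act U U' U'' (m : pairing U U' U'') (V : lmodule D) (u : U) :
  exists f : 'Hom(tens U' V, tens U'' V),
    forall u' v, f (pure u' v) = pure (m u u') v.
Proof.
apply: tens_univ => [v c x y|u' c x y|a u' v].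
- by rewrite pmul_linr pure_linl.
- exact: pure_linr.
by rewrite pmul_ract pure_balanced.
Qed.

(** The value on [u (x) t] is [pairing_act] applied to [t]; balancedness and left
    linearity of [m] are used in the variable [u]. *)
Lemma pairing_tens U U' U'' (m : pairing U U' U'') (V : lmodule D) :
  exists f : lmodhom (tens_lmodule U (tens_lmodule U' V)) (tens_lmodule U'' V),
    forall u u' v, f (pure u (pure u' v : tens_lmodule U' V)) = pure (m u u') v.
Proof.
have [b bE] := choice (pairing_act m V).
have := @tens_lmod_univ U (tens_lmodule U' V) (tens_lmodule U'' V) (fun u t => b u t).
case=> [t c x y|u|a u t|a u t|f fE]; last by exists f => u u' v; rewrite fE bE.
- rewrite -scale_lfunE -add_lfunE; congr (fun_of_lfun _ t); apply: tens_ext => u' v.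
  by rewrite add_lfunE scale_lfunE !bE pmul_linl pure_linl.
- exact: linearP.
- rewrite -[RHS]comp_lfunE; congr (fun_of_lfun _ t); apply: tens_ext => u' v.
  by rewrite [RHS]comp_lfunE lact_pure !bE pmul_balanced.
rewrite -[RHS]comp_lfunE; congr (fun_of_lfun _ t); apply: tens_ext => u' v.
by rewrite [RHS]comp_lfunE !bE lact_pure pmul_lact.
Qed.

Lemma pairing_nattrans U U' U'' (m : pairing U U' U'') :
  exists r : nattrans (fcomp (tens_functor U) (tens_functor U')) (tens_functor U''),
    forall (V : lmodule D) u u' (v : V),
      lmfun (r V) (pure u (pure u' v : tens_lmodule U' V)) = pure (m u u') v.
Proof.
have [r rE] := all_sig (fun V => cid (pairing_tens m V)).
unshelve refine (ex_intro _ (@NatTrans (modcat D) (modcat D) (fcomp (tens_functor U)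
  (tens_functor U')) (tens_functor U'') r _) rE).
move=> V V' g; apply: lmodhom_eq; apply: tens_ext2 => u u' v.
rewrite [LHS]comp_lfunE [RHS]comp_lfunE.
change (r V' (tens_hom U (tens_hom U' g) (pure u (pure u' v : tens_lmodule U' V)))
  = tens_hom U'' g (r V (pure u (pure u' v : tens_lmodule U' V)))).
by rewrite tens_hom_pure tens_hom_pure rE rE tens_hom_pure.
Qed.

(** A bimodule map from [D] to [U] is determined by the image [e] of 1, which
    can be any element on which the two actions of [D] agree. *)
Lemma unit_nattrans U (e : U) : (forall a, lact U a e = ract U a e) ->
  exists r : nattrans (fid (modcat D)) (tens_functor U),
    forall (V : lmodule D) (v : V), lmfun (r V) v = pure e v.
Proof.
move=> eC.
have ex (V : lmodule D) : exists f : lmodhom V (tens_lmodule U V),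
    forall v, f v = pure e v.
  have [f fE] := linear_homP (pure_linr (V := V) e).
  unshelve refine (ex_intro _ (@LModHom _ _ V (tens_lmodule U V) f _) fE).
  move=> a; apply/lfunP => v.
  by rewrite [LHS]comp_lfunE [RHS]comp_lfunE !fE lact_pure eC pure_balanced.
have [r rE] := all_sig (fun V => cid (ex V)).
unshelve refine (ex_intro _ (@NatTrans (modcat D) (modcat D) (fid (modcat D))
  (tens_functor U) r _) rE).
move=> V V' g; apply: lmodhom_eq; apply/lfunP => v.
rewrite [LHS]comp_lfunE [RHS]comp_lfunE.
change (r V' (g v) = tens_hom U g (r V v)).
by rewrite rE rE tens_hom_pure.
Qed.

(** Stated for a module [U'], the associativity of an algebra being the case in
    which [n] is [m]. *)
Lemma pairing_assoc U U' (m : pairing U U U) (n : pairing U' U U')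
    (mu : nattrans (fcomp (tens_functor U) (tens_functor U)) (tens_functor U))
    (rho : nattrans (fcomp (tens_functor U') (tens_functor U)) (tens_functor U')) :
    (forall (V : lmodule D) u u' (v : V),
      lmfun (mu V) (pure u (pure u' v : tens_lmodule U V)) = pure (m u u') v) ->
    (forall (V : lmodule D) u u' (v : V),
      lmfun (rho V) (pure u (pure u' v : tens_lmodule U V)) = pure (n u u') v) ->
    (forall s u u', n (n s u) u' = n s (m u u')) ->
  forall V, vcomp rho (hcomp rho (ntid (tens_functor U))) V
    = vcomp rho (hcomp (ntid (tens_functor U')) mu) V.
Proof.
move=> muE rhoE nA V.
rewrite !vcompE hcomp_ntidr hcomp_ntidl.
apply: lmodhom_eq; apply: tens_ext3 => s u u' v.
rewrite [LHS]comp_lfunE [RHS]comp_lfunE.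
set x := (pure u' v : tens_lmodule U V).
pose y := (pure u x : tens_lmodule U (tens_lmodule U V)).
rewrite [lmfun (rho (tens_functor U V)) _]rhoE.
(* [tens_hom U' (mu V)] is the morphism in the goal by conversion only, hence the
   use of [etrans] below. *)
have e := tens_hom_pure (mu V : lmodhom (tens_lmodule U (tens_lmodule U V)) _) s y.
rewrite [LHS]rhoE nA; apply: esym.
by apply: (etrans (congr1 (lmfun (rho V)) e)); rewrite muE rhoE.
Qed.

Lemma pairing_unitr U U' (e : U) (n : pairing U' U U')
    (eta : nattrans (fid (modcat D)) (tens_functor U))
    (rho : nattrans (fcomp (tens_functor U') (tens_functor U)) (tens_functor U')) :
    (forall (V : lmodule D) (v : V), lmfun (eta V) v = pure e v) ->
    (forall (V : lmodule D) u u' (v : V),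
      lmfun (rho V) (pure u (pure u' v : tens_lmodule U V)) = pure (n u u') v) ->
    (forall s, n s e = s) ->
  forall V, ntid (tens_functor U') V
    = vcomp rho (hcomp (ntid (tens_functor U')) eta) V.
Proof.
move=> etaE rhoE n1 V; apply: lmodhom_eq; apply: tens_ext => s v.
rewrite vcompE hcomp_ntidl [RHS]comp_lfunE [LHS]id_lfunE.
have etaV := tens_hom_pure (eta V : lmodhom V (tens_lmodule U V)) s v.
by apply/esym; apply: (etrans (congr1 (lmfun (rho V)) etaV)); rewrite etaE rhoE n1.
Qed.

Lemma pairing_unitl U (e : U) (m : pairing U U U)
    (eta : nattrans (fid (modcat D)) (tens_functor U))
    (mu : nattrans (fcomp (tens_functor U) (tens_functor U)) (tens_functor U)) :
    (forall (V : lmodule D) (v : V), lmfun (eta V) v = pure e v) ->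
    (forall (V : lmodule D) u u' (v : V),
      lmfun (mu V) (pure u (pure u' v : tens_lmodule U V)) = pure (m u u') v) ->
    (forall u, m e u = u) ->
  forall V, ntid (tens_functor U) V
    = vcomp mu (hcomp eta (ntid (tens_functor U))) V.
Proof.
move=> etaE muE m1 V; apply: lmodhom_eq; apply: tens_ext => u v.
rewrite vcompE hcomp_ntidr [RHS]comp_lfunE [LHS]id_lfunE.
have etaV := etaE (tens_lmodule U V) (pure u v).
by apply/esym; apply: (etrans (congr1 (lmfun (mu V)) etaV)); rewrite muE m1.
Qed.

Lemma pairing_algebra U U' (m : pairing U U U) (n : pairing U' U U') (e : U) :
    (forall u v w, m (m u v) w = m u (m v w)) ->
    (forall s u v, n (n s u) v = n s (m u v)) ->
    (forall a, lact U a e = ract U a e) ->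
    (forall u, m e u = u) -> (forall u, m u e = u) -> (forall s, n s e = s) ->
  exists sU : algebra (tens_functor U), inhabited (right_module sU (tens_functor U')).
Proof.
move=> mA nA eC m1l m1r n1r.
have [mu muE] := pairing_nattrans m; have [rho rhoE] := pairing_nattrans n.
have [eta etaE] := unit_nattrans eC.
exists (Algebra (pairing_assoc muE muE mA) (pairing_unitr etaE muE m1r)
  (pairing_unitl etaE muE m1l)).
split; exact: (@RightModule _ _ (Algebra _ _ _) _ _ (pairing_assoc muE rhoE nA)
  (pairing_unitr etaE rhoE n1r)).
Qed.

End Pairings.

(** * Products on quotients *)

Lemma quot_pi_eq (K : fieldType) (V : vectType K) (R : {vspace V}) x y :
  (quot_pi R x == quot_pi R y) = (x - y \in R).
Proof. by rewrite -quot_pi_eq0 linearB subr_eq0. Qed.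

Lemma quot_repr_pi (K : fieldType) (V : vectType K) (R : {vspace V}) x :
  quot_repr R (quot_pi R x) - x \in R.
Proof. by rewrite -quot_pi_eq quot_reprK. Qed.

Section QuotientPairing.
Variables (K : fieldType) (D : falgType K) (B1 B2 B3 : bimodule D).
Variables (R1 : {vspace B1}) (R2 : {vspace B2}) (R3 : {vspace B3}).
Hypotheses (l1 : forall a, (lact B1 a @: R1 <= R1)%VS)
           (r1 : forall a, (ract B1 a @: R1 <= R1)%VS)
           (l2 : forall a, (lact B2 a @: R2 <= R2)%VS)
           (r2 : forall a, (ract B2 a @: R2 <= R2)%VS)
           (l3 : forall a, (lact B3 a @: R3 <= R3)%VS)
           (r3 : forall a, (ract B3 a @: R3 <= R3)%VS).
Variable m : pairing B1 B2 B3.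
Hypothesis mR1 : forall x y, x \in R1 -> m x y \in R3.
Hypothesis mR2 : forall x y, y \in R2 -> m x y \in R3.

Definition quot_pmul (p : quot R1) (q : quot R2) : quot R3 :=
  quot_pi R3 (m (quot_repr R1 p) (quot_repr R2 q)).

Lemma pmul_subl x x' y : m (x - x') y = m x y - m x' y.
Proof. by rewrite -[x - x']addrC -scaleN1r pmul_linl scaleN1r addrC. Qed.

Lemma pmul_subr x y y' : m x (y - y') = m x y - m x y'.
Proof. by rewrite -[y - y']addrC -scaleN1r pmul_linr scaleN1r addrC. Qed.

(** The product of the representatives differs from that of [x] and [y] by a term
    with a left factor in [R1] and one with a right factor in [R2]. *)
Lemma quot_pmulE x y : quot_pmul (quot_pi R1 x) (quot_pi R2 y) = quot_pi R3 (m x y).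
Proof.
apply/eqP; rewrite quot_pi_eq; set x' := quot_repr _ _; set y' := quot_repr _ _.
have -> : m x' y' - m x y = m (x' - x) y' + m x (y' - y).
  by rewrite pmul_subl pmul_subr addrA subrK.
by apply: memvD; [apply: mR1|apply: mR2]; apply: quot_repr_pi.
Qed.

Let U1 := quot_bimodule l1 r1.
Let U2 := quot_bimodule l2 r2.
Let U3 := quot_bimodule l3 r3.

Lemma quot_pmul_linl (q : U2) : linear (quot_pmul^~ q : U1 -> U3).
Proof.
by move=> c x y; rewrite /quot_pmul linearP pmul_linl linearP.
Qed.

Lemma quot_pmul_linr (p : U1) : linear (quot_pmul p : U2 -> U3).
Proof.
by move=> c x y; rewrite /quot_pmul linearP pmul_linr linearP.
Qed.

Lemma quot_pmul_balanced a (p : U1) (q : U2) :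
  quot_pmul (ract U1 a p) q = quot_pmul p (lact U2 a q).
Proof.
rewrite -(quot_reprK p) -(quot_reprK q).
by rewrite /= !quot_mapE // !quot_pmulE pmul_balanced.
Qed.

Lemma quot_pmul_lact a (p : U1) (q : U2) :
  quot_pmul (lact U1 a p) q = lact U3 a (quot_pmul p q).
Proof.
rewrite -(quot_reprK p) -(quot_reprK q).
by rewrite /= quot_mapE // !quot_pmulE quot_mapE // pmul_lact.
Qed.

Lemma quot_pmul_ract a (p : U1) (q : U2) :
  quot_pmul p (ract U2 a q) = ract U3 a (quot_pmul p q).
Proof.
rewrite -(quot_reprK p) -(quot_reprK q).
by rewrite /= quot_mapE // !quot_pmulE quot_mapE // pmul_ract.
Qed.

Definition quot_pairing : pairing U1 U2 U3 :=
  Pairing quot_pmul_linl quot_pmul_linr quot_pmul_balanced quot_pmul_lact quot_pmul_ract.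

Lemma quot_pairingE x y :
  quot_pairing (quot_pi R1 x) (quot_pi R2 y) = quot_pi R3 (m x y).
Proof. exact: quot_pmulE. Qed.

End QuotientPairing.

(** * The product on M and its quotients *)

Section QuiverProduct.
Variables (K : fieldType) (k : nat).
Local Notation D := (dual_numbers K).
Local Notation M := (M_bimod K k).
Local Notation V := 'rV[K]_(2 * k + 3).

(** The coefficient of m_n, extended by 0 to all natural numbers: the vectors m_n
    with [n] out of range are then harmless, and the formulas for the
    actions and the product have no boundary cases. *)
Definition mcoef (v : V) (n : nat) : K := \sum_(j < 2 * k + 3 | j.+1 == n) v 0 j.

Lemma mcoef_ord v (j : 'I_(2 * k + 3)) : mcoef v j.+1 = v 0 j.
Proof. by rewrite /mcoef (big_pred1 j). Qed.

Lemma mcoef_out v n : ~~ (0 < n <= 2 * k + 3)%N -> mcoef v n = 0.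
Proof. by move=> out; rewrite /mcoef big_pred0 // => j; have := ltn_ord j; lia. Qed.

Lemma mcoef0 v : mcoef v 0 = 0.
Proof. exact: mcoef_out. Qed.

Lemma mcoef_row (F : nat -> K) n : (~~ (0 < n <= 2 * k + 3)%N -> F n = 0) ->
  mcoef (\row_j F j.+1) n = F n.
Proof.
case: (boolP (0 < n <= 2 * k + 3)%N) => [|out]; last by rewrite mcoef_out // => ->.
by case: n => // n lt _; rewrite (mcoef_ord _ (Ordinal lt)) mxE.
Qed.

Lemma mcoef_inj u v : (forall n, mcoef u n = mcoef v n) -> u = v.
Proof. by move=> e; apply/rowP => j; rewrite -!mcoef_ord. Qed.

Lemma mcoef_is_linear n : linear (mcoef^~ n : V -> K^o).
Proof.
move=> c u v; rewrite /mcoef scaler_sumr -big_split.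
by apply: eq_bigr => j _; rewrite !mxE.
Qed.

Lemma mcoefP n c u v : mcoef (c *: u + v) n = c * mcoef u n + mcoef v n.
Proof. exact: mcoef_is_linear. Qed.

Lemma mcoefZ n c v : mcoef (c *: v) n = c * mcoef v n.
Proof.
by have [h hE] := linear_homP (mcoef_is_linear n); rewrite -hE linearZ /= hE.
Qed.

Lemma mcoefB n u v : mcoef (u - v) n = mcoef u n - mcoef v n.
Proof.
by have [h hE] := linear_homP (mcoef_is_linear n); rewrite -hE linearB /= !hE.
Qed.

Lemma mcoef_mvec i n : n != i -> mcoef (mvec K k i) n = 0.
Proof.
move=> ni; rewrite /mcoef big1 // => j /eqP jn.
by rewrite mxE jn (negPf ni).
Qed.

(** A subspace spanned by basis vectors is cut out by the vanishing of the other
    coefficients. *)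
Lemma span_mvecP (s : seq nat) (v : V) :
  reflect (forall n, n \notin s -> mcoef v n = 0) (v \in <<map (@mvec K k) s>>%VS).
Proof.
apply: (iffP idP) => [vs n ns | v0].
  have [h hE] := linear_homP (mcoef_is_linear n).
  rewrite -hE (coord_span (X := in_tuple (map (@mvec K k) s)) vs) linear_sum.
  rewrite big1 // => i _; rewrite linearZ /= hE.
  have is_ : (i < size s)%N by rewrite -(size_map (@mvec K k)).
  rewrite (nth_map 0%N) // mcoef_mvec ?scaler0 //.
  by apply: contraNneq ns => ->; rewrite mem_nth.
rewrite (row_sum_delta v) memv_suml // => j _; rewrite -mvec_delta -mcoef_ord.
case: (boolP (j.+1 \in s)) => [js | /v0 ->]; last by rewrite scale0r mem0v.
by rewrite memvZ // memv_span // map_f.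
Qed.

Lemma S_relP (v : V) : reflect (forall n, n != 1%N -> mcoef v n = 0) (v \in S_rel K k).
Proof.
apply: (iffP (span_mvecP [:: 1%N] v)) => v0 n n1; apply: v0; move: n1; by rewrite inE.
Qed.

Lemma W_relP (v : V) :
  reflect (forall n, n != 1%N -> n != (2 * k + 3)%N -> mcoef v n = 0) (v \in W_rel K k).
Proof.
apply: (iffP (span_mvecP [:: 1; 2 * k + 3]%N v)) => v0 n.
  by move=> n1 n2; apply: v0; rewrite !inE negb_or n1.
by rewrite !inE negb_or => /andP[n1 n2]; apply: v0.
Qed.

Lemma S_rel_sub_W_rel v : v \in S_rel K k -> v \in W_rel K k.
Proof. by move/S_relP => v0; apply/W_relP => n n1 _; apply: v0. Qed.

Lemma mshift_coef f (v : V) j :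
  mshift K k f v 0 j = \sum_(i < 2 * k + 3 | odd i && (j.+1 == f i.+1./2)) v 0 i.
Proof.
rewrite lfunE /= mxE [RHS]big_mkcond; apply: eq_bigr => i _.
by rewrite mxE; case: ifP; rewrite (mulr1, mulr0).
Qed.

Lemma mcoef_xl (v : V) n : mcoef (xl K k v) n = if odd n then mcoef v n.-1 else 0.
Proof.
case: (boolP (0 < n <= 2 * k + 3)%N) => [|out]; last first.
  by rewrite mcoef_out //; case: ifP => // on; rewrite mcoef_out //; lia.
case: n => // j lt; rewrite (mcoef_ord _ (Ordinal lt)) mshift_coef.
case: ifP => oj; last by rewrite big_pred0 // => i /=; lia.
by apply: eq_bigl => i /=; lia.
Qed.

Lemma mcoef_xr (v : V) n : mcoef (xr K k v) n = if odd n then mcoef v n.+1 else 0.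
Proof.
case: (boolP (0 < n <= 2 * k + 3)%N) => [|out]; last first.
  by rewrite mcoef_out //; case: ifP => // on; rewrite mcoef_out //; lia.
case: n => // j lt; rewrite (mcoef_ord _ (Ordinal lt)) mshift_coef.
case: ifP => oj; last by rewrite big_pred0 // => i /=; lia.
by apply: eq_bigl => i /=; lia.
Qed.

Lemma mcoef_lact (a : D) (v : M) n : mcoef (lact M a v) n =
  a`_0 * mcoef v n + a`_1 * (if odd n then mcoef v n.-1 else 0).
Proof.
by rewrite /= /dual_act add_lfunE !scale_lfunE id_lfunE mcoefP mcoefZ mcoef_xl.
Qed.

Lemma mcoef_ract (a : D) (v : M) n : mcoef (ract M a v) n =
  a`_0 * mcoef v n + a`_1 * (if odd n then mcoef v n.+1 else 0).
Proof.
by rewrite /= /dual_act add_lfunE !scale_lfunE id_lfunE mcoefP mcoefZ mcoef_xr.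
Qed.

(** For m_n = a_j, with [n] = 2j+1, the two terms come from e_(j+1) a_j = a_j and
    a_j e_j = a_j; the even case says that the e_j are orthogonal idempotents. *)
Definition mmul_coef (u v : V) n : K :=
  if odd n then mcoef u n.+1 * mcoef v n + mcoef u n * mcoef v n.-1
  else mcoef u n * mcoef v n.

Definition mmul (u v : V) : V := \row_j mmul_coef u v j.+1.

Lemma mcoef_mul u v n : mcoef (mmul u v) n = mmul_coef u v n.
Proof.
apply: mcoef_row => out; rewrite /mmul_coef (mcoef_out v out) !mulr0.
by rewrite (mcoef_out u out) mul0r addr0 if_same.
Qed.

Lemma mmulA : associative mmul.
Proof.
move=> u v w; apply: mcoef_inj => -[|n];
  rewrite !mcoef_mul /mmul_coef !mcoef_mul /mmul_coef /=.
  by rewrite mulrA.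
rewrite ?negbK; case: (odd n) => /=; ring.
Qed.

Lemma mmul_linl v : linear (mmul^~ v).
Proof.
move=> c x y; apply: mcoef_inj => n.
rewrite mcoefP !mcoef_mul /mmul_coef !mcoefP; case: ifP => _; ring.
Qed.

Lemma mmul_linr u : linear (mmul u).
Proof.
move=> c x y; apply: mcoef_inj => n.
rewrite mcoefP !mcoef_mul /mmul_coef !mcoefP; case: ifP => _; ring.
Qed.

(** Both sides are the product of [u], [a] and [v] in the path algebra of the
    longer quiver modulo paths of length 2, where [a] acts through the sum of all
    arrows; the same reason applies to [mmul_lact] and [mmul_ract]. *)
Lemma mmul_balanced a (u v : M) : mmul (ract M a u) v = mmul u (lact M a v).
Proof.
apply: mcoef_inj => -[|n]; rewrite !mcoef_mul /mmul_coef !mcoef_lact !mcoef_ract /=.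
  by rewrite !mcoef0; ring.
rewrite ?negbK; case: (odd n) => /=; ring.
Qed.

Lemma mmul_lact a (u v : M) : mmul (lact M a u) v = lact M a (mmul u v : M).
Proof.
apply: mcoef_inj => -[|n].
  by rewrite !mcoef0.
rewrite mcoef_lact !mcoef_mul /mmul_coef !mcoef_lact /= ?negbK.
by case: (odd n) => /=; ring.
Qed.

Lemma mmul_ract a (u v : M) : mmul u (ract M a v) = ract M a (mmul u v : M).
Proof.
apply: mcoef_inj => -[|n].
  by rewrite !mcoef0.
rewrite mcoef_ract !mcoef_mul /mmul_coef !mcoef_ract /= ?negbK.
by case: (odd n) => /=; ring.
Qed.

Definition M_pairing : pairing M M M :=
  @Pairing K D M M M mmul mmul_linl mmul_linr mmul_balanced mmul_lact mmul_ract.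

Lemma mmul_S_rel (u v : V) : u \in S_rel K k -> mmul u v \in S_rel K k.
Proof.
move=> /S_relP u0; apply/S_relP => n n1; rewrite mcoef_mul /mmul_coef (u0 n) //.
case: ifP => on; rewrite ?mul0r // u0 ?mul0r ?addr0 //; lia.
Qed.

Lemma mmul_W_rel (u v : V) : u \in W_rel K k -> mmul u v \in W_rel K k.
Proof.
move=> /W_relP u0; apply/W_relP => n n1 n2; rewrite mcoef_mul /mmul_coef (u0 n) //.
case: ifP => on; rewrite ?mul0r // u0 ?mul0r ?addr0 //; lia.
Qed.

(** The last arrow is killed from the left because e_(k+2) is absent from M_k, so
    that only the multiples of m_1 survive. *)
Lemma mmul_relr (u v : V) : v \in W_rel K k -> mmul u v \in S_rel K k.
Proof.
move=> /W_relP v0; apply/S_relP => n n1; rewrite mcoef_mul /mmul_coef.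
case: ifP => on; last by rewrite v0 ?mulr0 //; lia.
rewrite (v0 n.-1) ?mulr0 ?addr0; try lia.
have [-> | n2] := eqVneq n (2 * k + 3)%N; first by rewrite mcoef_out ?mul0r //; lia.
by rewrite v0 ?mulr0.
Qed.

(** The sum of the e_j: the column [j] carries m_(j+1). *)
Definition munit : V := \row_j (odd j)%:R.

Lemma mcoef_unit n : (0 < n <= 2 * k + 3)%N -> mcoef munit n = (~~ odd n)%:R.
Proof.
by case: n => // j lt; rewrite (mcoef_ord _ (Ordinal lt)) mxE /= negbK.
Qed.

(** On M_k itself the two products with x are the sums of a_1, ..., a_(k+1) and of
    a_0, ..., a_k: they differ by the two ends, which vanish in W_k. *)
Lemma munit_central (a : D) : lact M a munit - ract M a munit \in W_rel K k.
Proof.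
apply/W_relP => n n1 n2; rewrite mcoefB mcoef_lact mcoef_ract.
case: ifP => on; last by rewrite subrr.
have [lt | ge] := ltnP n (2 * k + 3); last by rewrite !(mcoef_out munit) ?subrr //; lia.
have [e1 e2] : ~~ odd n.-1 /\ ~~ odd n.+1 by lia.
by rewrite (mcoef_unit (n := n.-1)) ?(mcoef_unit (n := n.+1)) ?e1 ?e2 ?subrr //; lia.
Qed.

(** The defect is along a_(k+1), as e_(k+2) is absent. *)
Lemma mmul_unitl (v : V) : mmul munit v - v \in W_rel K k.
Proof.
apply/W_relP => n n1 n2; rewrite mcoefB mcoef_mul /mmul_coef.
have [lt | ge] := boolP (0 < n < 2 * k + 3)%N; last first.
  by rewrite !(mcoef_out v (n := n)) ?mulr0 ?(mcoef_out munit (n := n)) ?mul0r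
    ?addr0 ?if_same ?subrr //; lia.
rewrite !mcoef_unit //=; try lia.
by case: (odd n); rewrite /= ?mul1r ?mul0r ?addr0 subrr.
Qed.

(** The defect is along a_0, as e_0 is absent.  It already vanishes in S_k, so the
    unit of W_k acts as the identity on S_k. *)
Lemma mmul_unitr (v : V) : mmul v munit - v \in S_rel K k.
Proof.
apply/S_relP => n n1; rewrite mcoefB mcoef_mul /mmul_coef.
have [lt | ge] := boolP (0 < n <= 2 * k + 3)%N; last first.
  by rewrite !(mcoef_out v (n := n)) ?(mcoef_out munit (n := n)) ?mul0r ?mulr0
    ?addr0 ?if_same ?subrr //; lia.
case: ifP => on; last by rewrite mcoef_unit // on mulr1 subrr.
have e : ~~ odd n.-1 by lia.
by rewrite (mcoef_unit lt) (mcoef_unit (n := n.-1)) ?on ?e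
   ?mulr0 ?mulr1 ?add0r ?subrr //; lia.
Qed.

Lemma WS_tensor_algebra :
  exists sW : algebra (tens_functor (W_bimod K k)),
    inhabited (right_module sW (tens_functor (S_bimod K k))).
Proof.
have mR2 (x y : M) : y \in W_rel K k -> M_pairing x y \in W_rel K k.
  by move=> yR; apply/S_rel_sub_W_rel/mmul_relr.
pose sl a : (lact M a @: S_rel K k <= S_rel K k)%VS := span_stable a (@S_rel_shift K k _).
pose sr a : (ract M a @: S_rel K k <= S_rel K k)%VS := span_stable a (@S_rel_shift K k _).
pose wl a : (lact M a @: W_rel K k <= W_rel K k)%VS := span_stable a (@W_rel_shift K k _).
pose wr a : (ract M a @: W_rel K k <= W_rel K k)%VS := span_stable a (@W_rel_shift K k _).
pose m : pairing (W_bimod K k) (W_bimod K k) (W_bimod K k) :=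
  quot_pairing (m := M_pairing) wl wr wl wr wl wr mmul_W_rel mR2.
pose n : pairing (S_bimod K k) (W_bimod K k) (S_bimod K k) :=
  quot_pairing (m := M_pairing) sl sr wl wr sl sr mmul_S_rel mmul_relr.
have mE (x y : M) : m (quot_pi _ x) (quot_pi _ y) = quot_pi _ (mmul x y).
  exact: quot_pairingE.
have nE (x y : M) : n (quot_pi _ x) (quot_pi _ y) = quot_pi _ (mmul x y).
  exact: quot_pairingE.
apply: (pairing_algebra (m := m) (n := n) (e := quot_pi (W_rel K k) munit)).
- move=> u v w; rewrite -(quot_reprK u) -(quot_reprK v) -(quot_reprK w).
  by rewrite !mE mmulA.
- move=> s u v; rewrite -(quot_reprK s) -(quot_reprK u) -(quot_reprK v).
  by rewrite mE !nE mmulA.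
- move=> a; rewrite /= !quot_mapE; [|exact: wr|exact: wl].
  by apply/eqP; rewrite quot_pi_eq munit_central.
- move=> u; rewrite -(quot_reprK u) mE.
  by apply/eqP; rewrite quot_pi_eq mmul_unitl.
- move=> u; rewrite -(quot_reprK u) mE.
  by apply/eqP; rewrite quot_pi_eq S_rel_sub_W_rel ?mmul_unitr.
- move=> s; rewrite -(quot_reprK s) nE.
  by apply/eqP; rewrite quot_pi_eq mmul_unitr.
Qed.

End QuiverProduct.

Theorem proposition18 (K : closedFieldType) (charK : [pchar K] =i pred0)
    (C : category) (E : functor C (modcat (dual_numbers K)))
    (eqE : equivalence E) (k : nat) (k_gt0 : (0 < k)%N)
    (W S : functor C C)
    (hW : represents E (W_bimod K k) W) (hS : represents E (S_bimod K k) S) :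
  exists sW : algebra W, inhabited (right_module sW S).
Proof.
have [sT [sN]] := WS_tensor_algebra K k.
exact: (algebra_module_transport eqE hW hS sN).
Qed.
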